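(* Let $n\in\mathbb N$ and let $m,M$ be positive real numbers satisfying \[ \frac{n}{M-n+1}\le m\le n-1+\frac{n}{M} \qquad\text{and}\qquad 0<m\le n\le M . \] Then there exists a finite Blaschke product $B$ of degree $n$ with $M(B)=M$ and $m(B)=m$.
   Context: A finite Blaschke product of degree $n$ is a function $B(z)=\alpha\prod_{k=1}^n \frac{z-a_k}{1-\overline{a_k}z}$ with $a_1,\dots,a_n\in\mathbb D=\{|z|<1\}$ and $\alpha\in\mathbb T=\{|z|=1\}$. For such $B$, $M(B)=\sup_{|z|=1}|B'(z)|$ and $m(B)=\inf_{|z|=1}|B'(z)|$. *)

(* Defs.v *)
From Stdlib Require Import Reals List.
From Coquelicot Require Import Coquelicot.
Open Scope R_scope.

Definition bfactor (a z : C) : C :=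
  Cdiv (Cminus z a) (Cminus 1%C (Cmult (Cconj a) z)).

Definition bprod (l : list C) (z : C) : C :=
  fold_right (fun a acc => Cmult (bfactor a z) acc) 1%C l.

Definition is_blaschke (n : nat) (B : C -> C) : Prop :=
  exists (alpha : C) (l : list C),
    Cmod alpha = 1 /\ length l = n /\ (forall a, In a l -> Cmod a < 1) /\
    (forall z, B z = Cmult alpha (bprod l z)).

Definition deriv_mods_circle (B : C -> C) (r : R) : Prop :=
  exists z dz : C, Cmod z = 1 /\ @is_derive C_AbsRing C_NormedModule B z dz /\ r = Cmod dz.

Definition is_glb (E : R -> Prop) (m : R) : Prop :=
  (forall x, E x -> m <= x) /\ (forall b, (forall x, E x -> b <= x) -> b <= m).

Definition Msup (B : C -> C) (M : R) : Prop := is_lub (deriv_mods_circle B) M.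
Definition minf (B : C -> C) (m : R) : Prop := is_glb (deriv_mods_circle B) m.

(* Main.v *)
(* Put weights w_0, ..., w_n > 0 of sum 1 at points ze_0, ..., ze_n of the unit circle which are in
   equilibrium for the logarithmic interaction, that is,
     sum_{k <> j} w_k cot((th_j - th_k) / 2) = 0  for all j,  where ze_k = e^{i th_k};
   a maximum of the energy sum_{j <> k} w_j w_k ln |ze_j - ze_k| is such a configuration.  The
   polynomial sum_k w_k prod_{j <> k} (z - ze_j) is monic of degree n with all roots in the open disc
   (Gauss-Lucas); let B be the Blaschke product with these zeros, so that z B(z) takes the same value
   at all ze_k.  The addition formula of the cotangent turns the equilibrium into the identity
     |B'(z)| + 1 = (sum_k w_k y_k) / (sum_k w_k^2 y_k),  y_k = 1 / |z - ze_k|^2,  |z| = 1,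
   while |B'(ze_k)| + 1 = 1 / w_k.  Hence |B'| + 1 is a weighted average of the numbers 1 / w_k and
   attains each of them, so that M(B) + 1 = max 1 / w_k and m(B) + 1 = min 1 / w_k.  It remains to take
   w_0 = 1 / (1 + M), w_1 = 1 / (1 + m) and the other n - 1 weights equal; the hypotheses on m and M
   say exactly that this common value can lie between w_0 and w_1. *)

Require Import Defs.
From Stdlib Require Import Reals List ZArith Lra Lia ClassicalChoice.
From Coquelicot Require Import Coquelicot.
Open Scope R_scope.

(** * Compactness of bounded families, finite sums, and angles modulo 2 pi *)

Lemma bounded_subsequence (u : nat -> R) (a b : R) :
  (forall i, a <= u i <= b) ->
  exists (s : nat -> nat) (l : R), filterlim s eventually eventually /\
    is_lim_seq (fun i => u (s i)) l.
Proof.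
intros Hu.
destruct (Bolzano_Weierstrass u _ (compact_P3 a b) Hu) as [l Hl].
assert (Hc : forall i, exists p, (i <= p)%nat /\ Rabs (u p - l) < / (INR i + 1)).
{ intros i.
  assert (Hp : 0 < / (INR i + 1)) by (apply Rinv_0_lt_compat; pose proof (pos_INR i); lra).
  destruct (Hl (disc l (mkposreal _ Hp)) i) as [p [Hp1 Hp2]].
  - exists (mkposreal _ Hp); intros x Hx; exact Hx.
  - exists p; split; [exact Hp1 | exact Hp2]. }
destruct (choice _ Hc) as [s Hs].
exists s, l; split.
- intros P [N HN]; exists N; intros i Hi; apply HN; destruct (Hs i); lia.
- apply is_lim_seq_spec; intros eps.
  destruct (archimed_cor1 eps (cond_pos eps)) as [N [HN1 HN2]].
  exists N; intros i Hi; destruct (Hs i) as [_ H1].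
  apply Rlt_trans with (1 := H1); apply Rle_lt_trans with (2 := HN1).
  apply Rinv_le_contravar; [apply lt_0_INR; lia|].
  apply le_INR in Hi; lra.
Qed.

(** Coordinates are treated one after the other: a further subsequence keeps the limits already
    obtained. *)
Lemma bounded_subsequence_family (N : nat) (x : nat -> nat -> R) (a b : R) :
  (forall i k, a <= x i k <= b) ->
  exists (s : nat -> nat) (l : nat -> R), filterlim s eventually eventually /\
    forall k, (k < N)%nat -> is_lim_seq (fun i => x (s i) k) (l k).
Proof.
intros Hx; induction N as [|N [s [l [Hs Hl]]]].
- exists (fun i => i), (fun _ => 0); split; [intros P HP; exact HP | intros k Hk; lia].
- destruct (bounded_subsequence (fun i => x (s i) N) a b) as [t [m [Ht Hm]]].
  { intros i; apply Hx. }
  exists (fun i => s (t i)), (fun k => if Nat.eq_dec k N then m else l k); split.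
  + apply (filterlim_comp _ _ _ t s eventually eventually eventually Ht Hs).
  + intros k Hk; destruct (Nat.eq_dec k N) as [->|Hne]; [exact Hm|].
    apply (is_lim_seq_subseq (fun i => x (s i) k)); [exact Ht | apply Hl; lia].
Qed.

Lemma is_lim_seq_sum_f_R0 (f : nat -> nat -> R) (l : nat -> R) (n : nat) :
  (forall k, (k <= n)%nat -> is_lim_seq (fun i => f i k) (l k)) ->
  is_lim_seq (fun i => sum_f_R0 (f i) n) (sum_f_R0 l n).
Proof.
induction n as [|n IH]; intros H; simpl; [apply H; lia|].
apply is_lim_seq_plus'; [apply IH; intros k Hk; apply H; lia | apply H; lia].
Qed.

Lemma is_derive_sum_f_R0 (f : nat -> R -> R) (l : nat -> R) (t : R) (n : nat) :
  (forall k, (k <= n)%nat -> is_derive (f k) t (l k)) ->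
  is_derive (fun u => sum_f_R0 (fun k => f k u) n) t (sum_f_R0 l n).
Proof.
induction n as [|n IH]; intros H; simpl; [apply H; lia|].
apply (@is_derive_plus R_AbsRing R_NormedModule); [apply IH; intros k Hk; apply H; lia | apply H; lia].
Qed.

Lemma locally_forall_le (P : nat -> R -> Prop) (t : R) (n : nat) :
  (forall k, (k <= n)%nat -> locally t (P k)) ->
  locally t (fun u => forall k, (k <= n)%nat -> P k u).
Proof.
induction n as [|n IH]; intros H.
- generalize (H 0%nat (le_n _)); apply filter_imp; intros u Hu k Hk.
  replace k with 0%nat by lia; exact Hu.
- generalize (filter_and _ _ (IH (fun k Hk => H k (le_S _ _ Hk))) (H _ (le_n _))).
  apply filter_imp; intros u [H1 H2] k Hk.
  destruct (Nat.eq_dec k (S n)) as [->|Hne]; [exact H2 | apply H1; lia].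
Qed.

Lemma sum_f_R0_exchange (f : nat -> nat -> R) (n m : nat) :
  sum_f_R0 (fun j => sum_f_R0 (fun k => f j k) m) n =
  sum_f_R0 (fun k => sum_f_R0 (fun j => f j k) n) m.
Proof.
induction n as [|n IH]; simpl; [reflexivity|].
rewrite IH, <- sum_plus; reflexivity.
Qed.

Lemma sum_f_R0_nonpos (f : nat -> R) (n : nat) :
  (forall k, (k <= n)%nat -> f k <= 0) -> sum_f_R0 f n <= 0.
Proof.
induction n as [|n IH]; intros H; simpl; [apply H; lia|].
assert (H1 := H (S n) (le_n _)).
assert (sum_f_R0 f n <= 0) by (apply IH; intros; apply H; lia); lra.
Qed.

Lemma sum_f_R0_le_term (f : nat -> R) (n j : nat) :
  (forall k, (k <= n)%nat -> f k <= 0) -> (j <= n)%nat -> sum_f_R0 f n <= f j.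
Proof.
induction n as [|n IH]; intros H Hj; simpl; [replace j with 0%nat by lia; lra|].
assert (H1 := H (S n) (le_n _)).
destruct (Nat.eq_dec j (S n)) as [->|Hne].
- assert (sum_f_R0 f n <= 0) by (apply sum_f_R0_nonpos; intros; apply H; lia); lra.
- assert (sum_f_R0 f n <= f j) by (apply IH; [intros; apply H; lia | lia]); lra.
Qed.

Lemma sum_f_R0_indicator (f : nat -> R) (n i : nat) : (i <= n)%nat ->
  sum_f_R0 (fun j => (if Nat.eq_dec j i then 1 else 0) * f j) n = f i.
Proof.
intros Hi; induction n as [|n IH]; cbn [sum_f_R0].
- destruct (Nat.eq_dec 0 i) as [<-|Hne]; [lra | lia].
- destruct (Nat.eq_dec (S n) i) as [<-|Hne].
  + rewrite (sum_eq _ (fun _ => 0)); [rewrite sum_cte; lra|].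
    intros j Hj; destruct (Nat.eq_dec j (S n)); [lia | lra].
  + rewrite IH; [lra | lia].
Qed.

Lemma local_max_derive_0 (f : R -> R) (t d : R) :
  is_derive f t d -> locally t (fun u => f u <= f t) -> d = 0.
Proof.
intros Hd [eps He].
apply is_derive_Reals in Hd.
assert (pr : derivable_pt f t) by (exists d; exact Hd).
rewrite <- (derive_pt_eq_0 f t d pr Hd).
apply (deriv_maximum f (t - eps) (t + eps)); try (generalize (cond_pos eps); lra).
intros u H1 H2; apply He.
apply Rabs_def1; unfold minus, plus, opp; simpl; lra.
Qed.

Lemma cos_IZR_period (x : R) (z : Z) : cos (x + 2 * IZR z * PI) = cos x.
Proof.
destruct z as [|p|p].
- f_equal; lra.
- rewrite <- (cos_period x (Pos.to_nat p)), INR_IZR_INZ, Znat.positive_nat_Z; reflexivity.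
- rewrite <- (cos_period (x + _) (Pos.to_nat p)), INR_IZR_INZ, Znat.positive_nat_Z.
  f_equal; rewrite <- Pos2Z.opp_pos, opp_IZR; lra.
Qed.

Lemma reduce_angle (x : R) :
  exists y, 0 <= y <= 2 * PI /\ exists z, y = x + 2 * IZR z * PI.
Proof.
assert (HP := PI_RGT_0).
pose (k := (up (x / (2 * PI)) - 1)%Z).
exists (x + 2 * IZR (- k) * PI); split; [|eauto].
destruct (archimed (x / (2 * PI))) as [H1 H2].
assert (Hk : IZR k = IZR (up (x / (2 * PI))) - 1) by (unfold k; rewrite minus_IZR; reflexivity).
rewrite opp_IZR.
assert (Hx : x = x / (2 * PI) * (2 * PI)) by (field; lra).
set (q := x / (2 * PI)) in *; rewrite Hk; split; nra.
Qed.

(** * Equilibrium of charges on the circle *)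

Section Energy.
Variables (n : nat) (w : nat -> R).
Hypothesis Hw : forall k, 0 < w k.

(** Distinctness of the points e^{i x_j}, as |e^{is} - e^{it}|^2 = 2 (1 - cos (s - t)). *)
Definition separated (x : nat -> R) : Prop :=
  forall j k, (j <= n)%nat -> (k <= n)%nat -> j <> k -> cos (x j - x k) < 1.

(* [(1 - cos (s - t)) / 2] is the squared half-distance of [e^{is}] and [e^{it}]; normalising it to
   be at most 1 makes every term of the energy nonpositive. *)
Definition pair_energy (x : nat -> R) (j k : nat) : R :=
  if Nat.eq_dec j k then 0 else w j * w k * ln ((1 - cos (x j - x k)) / 2).

Definition energy (x : nat -> R) : R :=
  sum_f_R0 (fun j => sum_f_R0 (fun k => pair_energy x j k) n) n.

Lemma pair_energy_nonpos (x : nat -> R) (j k : nat) :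
  separated x -> (j <= n)%nat -> (k <= n)%nat -> pair_energy x j k <= 0.
Proof.
intros Hx Hj Hk; unfold pair_energy; destruct (Nat.eq_dec j k) as [_|Hjk]; [lra|].
specialize (Hx j k Hj Hk Hjk).
destruct (COS_bound (x j - x k)) as [H1 _].
assert (0 < w j * w k) by (apply Rmult_lt_0_compat; apply Hw).
assert (ln ((1 - cos (x j - x k)) / 2) <= 0); [|nra].
rewrite <- ln_1; apply ln_le; lra.
Qed.

(** All terms are nonpositive, so dropping the others only increases the sum. A lower bound on the
    energy therefore keeps each pair of points apart. *)
Lemma energy_le_pair (x : nat -> R) (j k : nat) :
  separated x -> (j <= n)%nat -> (k <= n)%nat -> energy x <= pair_energy x j k.
Proof.
intros Hx Hj Hk; unfold energy.
apply Rle_trans with (sum_f_R0 (fun k => pair_energy x j k) n).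
- apply (sum_f_R0_le_term (fun j => sum_f_R0 (fun k => pair_energy x j k) n)); trivial.
  intros i Hi; apply sum_f_R0_nonpos; intros; apply pair_energy_nonpos; trivial.
- apply (sum_f_R0_le_term (fun k => pair_energy x j k)); trivial.
  intros; apply pair_energy_nonpos; trivial.
Qed.

Lemma energy_nonpos (x : nat -> R) : separated x -> energy x <= 0.
Proof.
intros Hx; apply sum_f_R0_nonpos; intros j Hj; apply sum_f_R0_nonpos; intros k Hk.
apply pair_energy_nonpos; trivial.
Qed.

Lemma separated_exists : exists x, separated x.
Proof.
(* Distinct angles in [0, 1) differ by less than 1 < pi, so the cosine of the difference is below
   1. *)
exists (fun k => INR k / (INR n + 1)); intros j k Hj Hk Hjk.
assert (Hn := pos_INR n); assert (Hj0 := pos_INR j); assert (Hk0 := pos_INR k).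
apply le_INR in Hj; apply le_INR in Hk.
assert (HP := PI2_3_2).
assert (Hd : INR j / (INR n + 1) - INR k / (INR n + 1) <> 0).
{ intros H; apply Hjk, INR_eq.
  apply Rminus_diag_uniq; apply Rmult_eq_reg_r with (/ (INR n + 1)).
  - lra.
  - apply Rinv_neq_0_compat; lra. }
assert (Hb : forall a, 0 <= a -> a <= INR n -> 0 <= a / (INR n + 1) < 1).
{ intros a H1 H2; split.
  - apply Rdiv_le_0_compat; lra.
  - apply Rmult_lt_reg_r with (INR n + 1); [lra|]; unfold Rdiv.
    rewrite Rmult_assoc, Rinv_l by lra; lra. }
destruct (Hb _ Hj0 Hj) as [A1 A2], (Hb _ Hk0 Hk) as [B1 B2].
set (d := INR j / (INR n + 1) - INR k / (INR n + 1)) in *.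
assert (Hpos : forall e, 0 < e < 1 -> cos e < 1).
{ intros e He; rewrite <- cos_0; apply cos_decreasing_1; lra. }
destruct (Rtotal_order d 0) as [H|[H|H]]; [|lra|].
- rewrite <- cos_neg; apply Hpos; unfold d in *; lra.
- apply Hpos; unfold d in *; lra.
Qed.

(** The energy sees only the points on the circle, so a maximising sequence may be taken with
    bounded angles. *)
Lemma energy_reduce (x : nat -> R) : separated x ->
  exists y, separated y /\ (forall k, 0 <= y k <= 2 * PI) /\ energy y = energy x.
Proof.
intros Hx.
destruct (choice _ (fun k => reduce_angle (x k))) as [y Hy].
assert (Hc : forall j k, cos (y j - y k) = cos (x j - x k)).
{ intros j k; destruct (Hy j) as [_ [a ->]], (Hy k) as [_ [b ->]].
  rewrite <- (cos_IZR_period (x j - x k) (a - b)), minus_IZR; f_equal; ring. }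
exists y; split; [|split].
- intros j k Hj Hk Hjk; rewrite Hc; apply Hx; trivial.
- intros k; apply Hy.
- unfold energy; apply sum_eq; intros j _; apply sum_eq; intros k _.
  unfold pair_energy; rewrite Hc; reflexivity.
Qed.

Lemma half_chord_lim (x : nat -> nat -> R) (l : nat -> R) (j k : nat) :
  is_lim_seq (fun i => x i j) (l j) -> is_lim_seq (fun i => x i k) (l k) ->
  is_lim_seq (fun i => (1 - cos (x i j - x i k)) / 2) ((1 - cos (l j - l k)) / 2).
Proof.
intros Hj Hk.
apply (is_lim_seq_continuous (fun d => (1 - cos d) / 2) (fun i => x i j - x i k) (l j - l k)).
- reg.
- apply is_lim_seq_minus'; trivial.
Qed.

Lemma energy_max : exists x, separated x /\ forall y, separated y -> energy y <= energy x.
Proof.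
pose (E := fun r => exists x, separated x /\ r = energy x).
destruct (completeness E) as [s [Hs1 Hs2]].
- exists 0; intros r [x [Hx ->]]; apply energy_nonpos, Hx.
- destruct separated_exists as [x Hx]; exists (energy x), x; auto.
- assert (Hi : forall i : nat, exists x : nat -> R, separated x /\
    (forall k, 0 <= x k <= 2 * PI) /\ s - / (INR i + 1) <= energy x).
  { intros i; apply NNPP; intros Hn.
    assert (Hp : 0 < / (INR i + 1)) by (apply Rinv_0_lt_compat; pose proof (pos_INR i); lra).
    assert (s <= s - / (INR i + 1)); [|lra].
    apply Hs2; intros r [x [Hx ->]]; apply Rnot_lt_le; intros Hlt; apply Hn.
    destruct (energy_reduce x Hx) as [y [Hy1 [Hy2 Hy3]]].
    exists y; split; [exact Hy1 | split; [exact Hy2 | lra]]. }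
  destruct (choice _ Hi) as [x Hx]; clear Hi.
  destruct (bounded_subsequence_family (S n) x 0 (2 * PI)) as [t [l [Ht Hl]]].
  { intros i k; apply Hx. }
  assert (Hsep : separated l).
  { intros j k Hj Hk Hjk.
    (* Along the sequence the energy is at least [s - 1], so by [energy_le_pair] each squared
       half-chord is at least this [d > 0]; no two points collide in the limit. *)
    pose (d := exp ((s - 1) / (w j * w k))).
    assert (Hww : 0 < w j * w k) by (apply Rmult_lt_0_compat; apply Hw).
    assert (d <= (1 - cos (l j - l k)) / 2).
    { assert (Hlim := half_chord_lim (fun i => x (t i)) l j k
        (Hl j (le_n_S _ _ Hj)) (Hl k (le_n_S _ _ Hk))).
      apply (is_lim_seq_le (fun _ => d) _ d _) with (3 := Hlim); [|apply is_lim_seq_const].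
      intros i; destruct (Hx (t i)) as [Hx1 [_ Hx2]].
      assert (He := energy_le_pair _ j k Hx1 Hj Hk).
      unfold pair_energy in He; destruct (Nat.eq_dec j k) as [?|_]; [contradiction|].
      specialize (Hx1 j k Hj Hk Hjk).
      assert (/ (INR (t i) + 1) <= 1).
      { rewrite <- Rinv_1 at 2; apply Rinv_le_contravar; [lra|].
        pose proof (pos_INR (t i)); lra. }
      rewrite <- (exp_ln ((1 - cos (x (t i) j - x (t i) k)) / 2)) by lra.
      unfold d; apply Rnot_lt_le; intros Hlt; apply exp_lt_inv in Hlt; revert Hlt; apply Rle_not_lt.
      apply Rmult_le_reg_r with (w j * w k); [exact Hww|].
      unfold Rdiv at 1; rewrite Rmult_assoc, Rinv_l by lra; lra. }
    assert (0 < d) by apply exp_pos; lra. }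
  exists l; split; [exact Hsep|]; intros y Hy.
  apply Rle_trans with s; [apply Hs1; exists y; auto|].
  assert (Hlim : is_lim_seq (fun i => energy (x (t i))) (energy l)).
  { apply is_lim_seq_sum_f_R0; intros j Hj; apply is_lim_seq_sum_f_R0; intros k Hk.
    unfold pair_energy; destruct (Nat.eq_dec j k) as [_|Hjk]; [apply is_lim_seq_const|].
    apply (is_lim_seq_scal_l _ (w j * w k) (ln ((1 - cos (l j - l k)) / 2))).
    apply (is_lim_seq_continuous ln (fun i => (1 - cos (x (t i) j - x (t i) k)) / 2)).
    - apply derivable_continuous_pt; exists (/ ((1 - cos (l j - l k)) / 2)).
      apply derivable_pt_lim_ln; specialize (Hsep j k Hj Hk Hjk); lra.
    - apply (half_chord_lim (fun i => x (t i))); apply Hl; lia. }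
  assert (Hlow : is_lim_seq (fun i => s - / (INR (t i) + 1)) s).
  { replace (Finite s) with (Finite (s - 0)) by (f_equal; lra).
    apply is_lim_seq_minus'; [apply is_lim_seq_const|].
    apply (is_lim_seq_subseq (fun i => / (INR i + 1)) 0 t Ht).
    replace (Finite 0) with (Rbar_inv p_infty) by reflexivity.
    apply is_lim_seq_inv; [|discriminate].
    apply is_lim_seq_plus with p_infty 1; [apply is_lim_seq_INR | apply is_lim_seq_const | reflexivity]. }
  apply (is_lim_seq_le _ _ s (energy l)) with (2 := Hlow) (3 := Hlim).
  intros i; apply Hx.
Qed.

(** The logarithmic derivative of 1 - cos u is sin u / (1 - cos u) = cot (u / 2), the force between
    two charges. *)
Lemma energy_derive (l v : nat -> R) : separated l ->
  is_derive (fun t => energy (fun k => l k + t * v k)) 0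
   (sum_f_R0 (fun j => sum_f_R0 (fun k => if Nat.eq_dec j k then 0 else
      w j * w k * ((v j - v k) * (sin (l j - l k) / (1 - cos (l j - l k))))) n) n).
Proof.
intros Hl; apply is_derive_sum_f_R0; intros j Hj.
apply (is_derive_sum_f_R0 (fun k t => pair_energy (fun k => l k + t * v k) j k)); intros k Hk.
unfold pair_energy; destruct (Nat.eq_dec j k) as [_|Hjk]; [apply (@is_derive_const R_AbsRing R_NormedModule)|].
specialize (Hl j k Hj Hk Hjk).
auto_derive.
- replace (l j + 0 * v j + - (l k + 0 * v k)) with (l j - l k) by ring; lra.
- replace (l j + 0 * v j + - (l k + 0 * v k)) with (l j - l k) by ring; field; lra.
Qed.

(** Separation consists of finitely many open conditions, so small displacements are admissible
    competitors for the maximum. *)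
Lemma separated_near (l v : nat -> R) : separated l ->
  locally 0 (fun t => separated (fun k => l k + t * v k)).
Proof.
intros Hl.
assert (H : locally 0 (fun t => forall j, (j <= n)%nat -> forall k, (k <= n)%nat ->
   j <> k -> cos (l j + t * v j - (l k + t * v k)) < 1)).
{ apply locally_forall_le; intros j Hj; apply locally_forall_le; intros k Hk.
  destruct (Nat.eq_dec j k) as [Heq|Hjk].
  - apply filter_forall; intros t Hne; contradiction.
  - assert (Hc : continuous (fun t => cos (l j + t * v j - (l k + t * v k))) 0).
    { apply (@ex_derive_continuous R_AbsRing R_NormedModule); auto_derive; trivial. }
    assert (H1 := Hl j k Hj Hk Hjk).
    generalize (Hc (fun y => y < 1)); intros Hc'.
    assert (Hf : filtermap (fun t => cos (l j + t * v j - (l k + t * v k))) (locally 0) (fun y => y < 1)).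
    { apply Hc', open_lt.
      replace (l j + 0 * v j - (l k + 0 * v k)) with (l j - l k) by ring; exact H1. }
    unfold filtermap in Hf; revert Hf; apply filter_imp; intros t Ht _; exact Ht. }
revert H; apply filter_imp; intros t Ht j k Hj Hk Hjk; apply Ht; trivial.
Qed.

(** First-order condition at a maximum of the energy when only the i-th point moves. *)
Lemma equilibrium : exists x, separated x /\ forall i, (i <= n)%nat ->
  sum_f_R0 (fun k => if Nat.eq_dec i k then 0 else
     w k * (sin (x i - x k) / (1 - cos (x i - x k)))) n = 0.
Proof.
destruct energy_max as [l [Hl Hmax]]; exists l; split; [exact Hl|]; intros i Hi.
pose (v := fun j => if Nat.eq_dec j i then 1 else 0).
pose (A := fun j k => if Nat.eq_dec j k then 0 else
  w j * w k * (sin (l j - l k) / (1 - cos (l j - l k)))).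
assert (HA : forall j k, A k j = - A j k).
{ intros j k; unfold A; destruct (Nat.eq_dec k j), (Nat.eq_dec j k); try lia; try lra.
  replace (l k - l j) with (- (l j - l k)) by ring; rewrite sin_neg, cos_neg; lra. }
assert (H0 := local_max_derive_0 _ _ _ (energy_derive l v Hl)).
assert (HD : sum_f_R0 (fun j => sum_f_R0 (fun k => if Nat.eq_dec j k then 0 else
      w j * w k * ((v j - v k) * (sin (l j - l k) / (1 - cos (l j - l k))))) n) n =
  2 * sum_f_R0 (A i) n).
(* Antisymmetry of [A] turns [- v k * A j k] into [v k * A k j], so both halves of [v j - v k] give
   the same double sum; the indicator [v] then leaves row [i] twice. *)
{ transitivity (sum_f_R0 (fun j => sum_f_R0 (fun k => v j * A j k) n) n +
     sum_f_R0 (fun j => sum_f_R0 (fun k => v k * A k j) n) n).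
  - rewrite <- sum_plus; apply sum_eq; intros j _; rewrite <- sum_plus; apply sum_eq; intros k _.
    rewrite (HA j k); unfold A; destruct (Nat.eq_dec j k); lra.
  - rewrite (sum_f_R0_exchange (fun j k => v k * A k j)).
    rewrite (sum_eq _ (fun j => v j * sum_f_R0 (A j) n)).
    + unfold v; rewrite sum_f_R0_indicator; trivial; lra.
    + intros j _; rewrite scal_sum; apply sum_eq; intros; ring. }
rewrite HD in H0.
assert (HAi : sum_f_R0 (A i) n = 0).
{ assert (2 * sum_f_R0 (A i) n = 0); [|lra].
  apply H0; generalize (separated_near l v Hl); apply filter_imp; intros t Ht.
  replace (energy (fun k => l k + 0 * v k)) with (energy l); [apply Hmax, Ht|].
  unfold energy; apply sum_eq; intros j _; apply sum_eq; intros k _; unfold pair_energy.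
  replace (l j + 0 * v j - (l k + 0 * v k)) with (l j - l k) by ring; reflexivity. }
apply Rmult_eq_reg_l with (w i); [|apply Rgt_not_eq, Hw].
rewrite Rmult_0_r, scal_sum; transitivity (sum_f_R0 (A i) n); [apply sum_eq; intros k _ | exact HAi].
unfold A; destruct (Nat.eq_dec i k); ring.
Qed.
End Energy.

(** * The choice of the weights *)

Lemma sum_f_R0_pos (f : nat -> R) (n : nat) :
  (forall k, (k <= n)%nat -> 0 < f k) -> 0 < sum_f_R0 f n.
Proof.
induction n as [|n IH]; intros H; simpl; [apply H; lia|].
apply Rplus_lt_0_compat; [apply IH; intros; apply H; lia | apply H; lia].
Qed.

(** Since w_k y_k = (1 / w_k) w_k^2 y_k, the number F is the average of the 1 / w_k with weights
    w_k^2 y_k. *)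
Lemma weighted_average_bounds (n : nat) (w y : nat -> R) (a b F : R) :
  0 < a -> (forall k, a <= w k <= b) -> (forall k, (k <= n)%nat -> 0 < y k) ->
  F * sum_f_R0 (fun k => w k * w k * y k) n = sum_f_R0 (fun k => w k * y k) n ->
  / b <= F <= / a.
Proof.
intros Ha Hw Hy HF.
assert (Hb : 0 < b) by (specialize (Hw 0%nat); lra).
set (S := sum_f_R0 (fun k => w k * w k * y k) n) in *.
assert (HS : 0 < S).
{ apply sum_f_R0_pos; intros k Hk; specialize (Hw k); specialize (Hy k Hk).
  repeat apply Rmult_lt_0_compat; lra. }
assert (H1 : S <= b * (F * S)).
{ rewrite HF, scal_sum; apply sum_Rle; intros k Hk; specialize (Hw k); specialize (Hy k Hk).
  assert (0 < w k * y k) by (apply Rmult_lt_0_compat; lra); nra. }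
assert (H2 : a * (F * S) <= S).
{ rewrite HF, scal_sum; apply sum_Rle; intros k Hk; specialize (Hw k); specialize (Hy k Hk).
  assert (0 < w k * y k) by (apply Rmult_lt_0_compat; lra); nra. }
split.
- apply Rmult_le_reg_l with b; [exact Hb|]; rewrite Rinv_r by lra; nra.
- apply Rmult_le_reg_l with a; [exact Ha|]; rewrite Rinv_r by lra; nra.
Qed.

Lemma charge_weights (n : nat) (m M : R) :
  0 < m -> 0 < M ->
  INR n / (M - INR n + 1) <= m -> m <= INR n - 1 + INR n / M ->
  m <= INR n -> INR n <= M ->
  exists w : nat -> R, (forall k, / (1 + M) <= w k <= / (1 + m)) /\
    sum_f_R0 w n = 1 /\ w 0%nat = / (1 + M) /\ w 1%nat = / (1 + m).
Proof.
intros Hm HM H1 H2 H3 H4.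
destruct n as [|p]; [simpl in H3; lra|].
assert (Hp := pos_INR p); rewrite S_INR in *.
set (a := / (1 + M)); set (b := / (1 + m)).
assert (Ha : a * (1 + M) = 1) by (unfold a; field; lra).
assert (Hb : b * (1 + m) = 1) by (unfold b; field; lra).
assert (Hab : a <= b) by (unfold a, b; apply Rinv_le_contravar; lra).
assert (Ha0 : 0 < a) by (unfold a; apply Rinv_0_lt_compat; lra).
assert (Hb0 : 0 < b) by (unfold b; apply Rinv_0_lt_compat; lra).
assert (E1 : INR p + 1 <= m * (M - INR p)).
{ apply Rmult_le_compat_r with (r := M - INR p) in H1; [|lra].
  replace (M - (INR p + 1) + 1) with (M - INR p) in H1 by ring.
  unfold Rdiv in H1; rewrite Rmult_assoc, Rinv_l in H1 by lra; lra. }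
assert (E2 : m * M <= INR p * M + INR p + 1).
{ apply Rmult_le_compat_r with (r := M) in H2; [|lra].
  replace ((INR p + 1 - 1 + (INR p + 1) / M) * M) with (INR p * M + INR p + 1) in H2
    by (field; lra); exact H2. }
assert (Hx : exists x, a <= x <= b /\ a + b + INR p * x = 1).
(* With p = n - 1, multiplying by (1 + M)(1 + m) reduces [L1] to [E1] and [L2] to [E2]. *)
{ assert (L1 : INR p * a <= 1 - a - b).
  { apply Rmult_le_reg_r with ((1 + M) * (1 + m)); [nra|].
    replace (INR p * a * ((1 + M) * (1 + m))) with (INR p * (a * (1 + M)) * (1 + m)) by ring.
    replace ((1 - a - b) * ((1 + M) * (1 + m))) with
      ((1 + M) * (1 + m) - a * (1 + M) * (1 + m) - b * (1 + m) * (1 + M)) by ring.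
    rewrite Ha, Hb; lra. }
  assert (L2 : 1 - a - b <= INR p * b).
  { apply Rmult_le_reg_r with ((1 + M) * (1 + m)); [nra|].
    replace (INR p * b * ((1 + M) * (1 + m))) with (INR p * (b * (1 + m)) * (1 + M)) by ring.
    replace ((1 - a - b) * ((1 + M) * (1 + m))) with
      ((1 + M) * (1 + m) - a * (1 + M) * (1 + m) - b * (1 + m) * (1 + M)) by ring.
    rewrite Ha, Hb; lra. }
  destruct Hp as [Hp|Hp].
  - exists ((1 - a - b) / INR p); split; [split|].
    + apply Rmult_le_reg_l with (INR p); [exact Hp|].
      replace (INR p * ((1 - a - b) / INR p)) with (1 - a - b) by (field; lra); exact L1.
    + apply Rmult_le_reg_l with (INR p); [exact Hp|].
      replace (INR p * ((1 - a - b) / INR p)) with (1 - a - b) by (field; lra); exact L2.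
    + field; lra.
  (* For n = 1 the bounds [L1] and [L2] force a + b = 1; no mass is left and [x] is a filler. *)
  - rewrite <- Hp in *; exists a; lra. }
destruct Hx as [x [Hx Hsum]].
exists (fun k => match k with 0%nat => a | 1%nat => b | _ => x end).
split; [|split; [|split; reflexivity]].
- intros [|[|k]]; lra.
- rewrite <- Hsum; clear; induction p as [|p IH]; [simpl; lra|].
  rewrite tech5, IH, S_INR; ring.
Qed.

(** * The derivative of a Blaschke product on the circle *)

(* A quadratic remainder is easier to carry through products and quotients than [is_derive]. *)
Definition second_order (f : C -> C) (z d : C) : Prop :=
  exists K eps : R, 0 <= K /\ 0 < eps /\ forall h : C, Cmod h < eps ->
    exists r : C, f (z + h)%C = (f z + h * d + h * h * r)%C /\ Cmod r <= K.

Lemma second_order_const (c z : C) : second_order (fun _ => c) z 0%C.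
Proof.
exists 0, 1; split; [lra|]; split; [lra|]; intros h _.
exists 0%C; rewrite Cmod_0; split; [ring | lra].
Qed.

Lemma second_order_mult (f g : C -> C) (z d e : C) :
  second_order f z d -> second_order g z e ->
  second_order (fun w => Cmult (f w) (g w)) z (d * g z + f z * e)%C.
Proof.
intros [K [eps [HK [He Hf]]]] [L [eta [HL [Ht Hg]]]].
(* Termwise bound of the h^2 coefficient of the product; powers of h are absorbed by |h| < 1, hence
   the 1 in the minimum. *)
exists (Cmod d * Cmod e + K * (Cmod (g z) + Cmod e + L) + (Cmod (f z) + Cmod d) * L).
exists (Rmin 1 (Rmin eps eta)).
assert (Hd := Cmod_ge_0 d); assert (He' := Cmod_ge_0 e).
assert (Hfz := Cmod_ge_0 (f z)); assert (Hgz := Cmod_ge_0 (g z)).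
split; [|split].
- repeat apply Rplus_le_le_0_compat; repeat apply Rmult_le_pos; lra.
- repeat apply Rmin_glb_lt; lra.
- intros h Hh.
  assert (H1 := Rlt_le_trans _ _ _ Hh (Rmin_l _ _)).
  assert (H2 := Rlt_le_trans _ _ _ Hh (Rmin_r _ _)).
  destruct (Hf h (Rlt_le_trans _ _ _ H2 (Rmin_l _ _))) as [r [Hr1 Hr2]].
  destruct (Hg h (Rlt_le_trans _ _ _ H2 (Rmin_r _ _))) as [s [Hs1 Hs2]].
  exists (d * e + r * (g z + h * e + h * h * s) + (f z + h * d) * s)%C; split.
  + rewrite Hr1, Hs1; ring.
  + assert (Hh0 := Cmod_ge_0 h).
    assert (Hr0 := Cmod_ge_0 r); assert (Hs0 := Cmod_ge_0 s).
    assert (B1 : Cmod (g z + h * e + h * h * s)%C <= Cmod (g z) + Cmod e + L).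
    { eapply Rle_trans; [apply Cmod_triangle|]; apply Rplus_le_compat.
      - eapply Rle_trans; [apply Cmod_triangle|]; rewrite Cmod_mult; nra.
      - rewrite !Cmod_mult; assert (Cmod h * Cmod h <= 1) by nra; nra. }
    assert (B2 : Cmod (f z + h * d)%C <= Cmod (f z) + Cmod d).
    { eapply Rle_trans; [apply Cmod_triangle|]; rewrite Cmod_mult; nra. }
    assert (B0 := Cmod_ge_0 (g z + h * e + h * h * s)%C).
    assert (B0' := Cmod_ge_0 (f z + h * d)%C).
    eapply Rle_trans; [apply Cmod_triangle|]; apply Rplus_le_compat.
    * eapply Rle_trans; [apply Cmod_triangle|]; rewrite !Cmod_mult.
      apply Rplus_le_compat; [lra | apply Rmult_le_compat; lra].
    * rewrite !Cmod_mult; apply Rmult_le_compat; lra.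
Qed.

Lemma second_order_is_derive (f : C -> C) (z d : C) :
  second_order f z d -> @is_derive C_AbsRing C_NormedModule f z d.
Proof.
intros [K [eps [HK [He Hf]]]]; split; [apply is_linear_scal_l|].
intros x Hx e; 
apply (@is_filter_lim_locally_unique C_AbsRing (AbsRing_NormedModule C_AbsRing) z x) in Hx.
subst x.
apply (@locally_le_locally_norm C_AbsRing (AbsRing_NormedModule C_AbsRing) z).
assert (Hpos : 0 < Rmin eps (e / (K + 1))).
{ apply Rmin_glb_lt; [lra|]; apply Rdiv_lt_0_compat; [apply cond_pos | lra]. }
exists (mkposreal _ Hpos).
change (forall y : C, Cmod (y - z)%C < Rmin eps (e / (K + 1)) ->
  Cmod (f y - f z - (y - z) * d)%C <= e * Cmod (y - z)%C).
intros y Hy.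
destruct (Hf (y - z)%C (Rlt_le_trans _ _ _ Hy (Rmin_l _ _))) as [r [Hr1 Hr2]].
replace (z + (y - z))%C with y in Hr1 by ring.
rewrite Hr1.
replace (f z + (y - z) * d + (y - z) * (y - z) * r - f z - (y - z) * d)%C
  with ((y - z) * r * (y - z))%C by ring.
rewrite !Cmod_mult; apply Rmult_le_compat_r; [apply Cmod_ge_0|].
assert (H1 := Rlt_le_trans _ _ _ Hy (Rmin_r _ _)).
assert (H0 := Cmod_ge_0 (y - z)%C); assert (Hr0 := Cmod_ge_0 r).
apply Rle_trans with (e / (K + 1) * (K + 1)); [apply Rmult_le_compat; lra|].
unfold Rdiv; rewrite Rmult_assoc, Rinv_l by lra; lra.
Qed.

(** For |z| = 1 and |a| < 1 this is the Poisson kernel, and also the modulus of the derivative of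
    [bfactor a] at z. *)
Definition poisson (a z : C) : R := (1 - Cmod a ^ 2) / Cmod (z - a)%C ^ 2.

Definition poisson_sum (l : list C) (z : C) : R :=
  fold_right (fun a s => poisson a z + s) 0 l.

Section Factor.
Variables a z : C.
Hypotheses (Ha : Cmod a < 1) (Hz : Cmod z = 1).

Lemma Cconj_unit : (z * Cconj z = 1)%C.
Proof. rewrite <- Cmod2_conj, Hz; f_equal; ring. Qed.

(** Writing 1 as z times its conjugate factors out z; hence numerator and denominator of a Blaschke
    factor have equal modulus on the circle. *)
Lemma denominator_circle : (1 - Cconj a * z = z * Cconj (z - a))%C.
Proof.
rewrite <- Cconj_unit; unfold Cminus; rewrite Cplus_conj, Copp_conj; ring.
Qed.

Lemma Cmod_sub_pos : 0 < Cmod (z - a)%C.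
Proof.
apply Cmod_gt_0; intros H; apply (Rlt_irrefl 1).
rewrite <- Hz at 1; replace z with a; [exact Ha|].
replace z with (z - a + a)%C by ring; rewrite H; ring.
Qed.

Lemma numerator_neq0 : (z - a <> 0)%C.
Proof. apply Cmod_gt_0, Cmod_sub_pos. Qed.

Lemma denominator_mod : Cmod (1 - Cconj a * z)%C = Cmod (z - a)%C.
Proof. rewrite denominator_circle, Cmod_mult, Cmod_conj, Hz; ring. Qed.

Lemma denominator_neq0 : (1 - Cconj a * z <> 0)%C.
Proof. apply Cmod_gt_0; rewrite denominator_mod; apply Cmod_sub_pos. Qed.

Lemma bfactor_mod : Cmod (bfactor a z) = 1.
Proof.
unfold bfactor; rewrite Cmod_div; [|apply denominator_neq0].
rewrite denominator_mod; field; apply Rgt_not_eq, Cmod_sub_pos.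
Qed.

Lemma poisson_nonneg : 0 <= poisson a z.
Proof.
unfold poisson; assert (H := Cmod_sub_pos); assert (H0 := Cmod_ge_0 a).
apply Rdiv_le_0_compat; [nra | apply pow_lt, H].
Qed.

(** As z b' / b is real and nonnegative on the circle, the factors of a product contribute to |B'|
    without cancellation. *)
Lemma bfactor_second_order : exists d,
  second_order (bfactor a) z d /\ (z * d = RtoC (poisson a z) * bfactor a z)%C.
Proof.
assert (Hd := denominator_neq0); assert (Hn := numerator_neq0).
assert (Hmod := denominator_mod); assert (Hpos := Cmod_sub_pos).
set (D := (1 - Cconj a * z)%C) in *.
exists ((1 - a * Cconj a) / (D * D))%C; split.
(* [c] is also |D|; for |h| < c / 2 and |a| < 1 the denominator at z + h keeps modulus at least c /
   2. *)
- pose (c := Cmod (z - a)%C).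
  pose (N := Cmod (Cconj a * (1 - a * Cconj a) / (D * D))%C).
  exists (N * / (c / 2)), (c / 2).
  assert (HN : 0 <= N) by apply Cmod_ge_0.
  assert (Hc : 0 < c) by exact Hpos.
  split; [|split; [lra|]].
  + apply Rmult_le_pos; [exact HN | apply Rlt_le, Rinv_0_lt_compat; lra].
  + intros h Hh.
    assert (HD : c / 2 <= Cmod (D - Cconj a * h)%C).
    { assert (HT := Cmod_triangle (D - Cconj a * h)%C (Cconj a * h)%C).
      replace (D - Cconj a * h + Cconj a * h)%C with D in HT by ring.
      rewrite Hmod, Cmod_mult, Cmod_conj in HT; fold c in HT.
      assert (H0 := Cmod_ge_0 h); assert (H1 := Cmod_ge_0 a); nra. }
    assert (HD0 : (D - Cconj a * h <> 0)%C) by (apply Cmod_gt_0; lra).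
    (* Exact remainder, from b(z + h) - b(z) = h (1 - |a|^2) / (D (D - conj(a) h)). *)
    exists (Cconj a * (1 - a * Cconj a) / (D * D) / (D - Cconj a * h))%C; split.
    * unfold bfactor; replace (1 - Cconj a * (z + h))%C with (D - Cconj a * h)%C by (unfold D; ring).
      fold D; unfold D in *; field; split; assumption.
    * rewrite Cmod_div by exact HD0; fold N.
      apply Rmult_le_compat_l; [exact HN|]; apply Rinv_le_contravar; lra.
- unfold poisson, bfactor; fold D.
  rewrite RtoC_div by (apply pow_nonzero, Rgt_not_eq, Hpos).
  rewrite RtoC_minus, Cmod2_conj, Cmod2_conj.
  assert (HD : D = (z * Cconj (z - a))%C) by apply denominator_circle.
  assert (Hz0 : z <> 0%C) by (apply Cmod_gt_0; lra).
  assert (Hcj : Cconj (z - a)%C <> 0%C).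
  { intros H; apply Hd; rewrite HD, H; ring. }
  rewrite HD; field; auto.
Qed.
End Factor.

Lemma bprod_second_order (l : list C) (z : C) :
  (forall a, In a l -> Cmod a < 1) -> Cmod z = 1 ->
  exists d, second_order (bprod l) z d /\
    (z * d = RtoC (poisson_sum l z) * bprod l z)%C /\ Cmod (bprod l z) = 1.
Proof.
intros Hl Hz; induction l as [|a l IH].
- exists 0%C; split; [apply (second_order_const 1%C)|]; simpl; split; [ring | apply Cmod_1].
- destruct IH as [e [He1 [He2 He3]]]; [intros b Hb; apply Hl; right; exact Hb|].
  destruct (bfactor_second_order a z (Hl a (or_introl eq_refl)) Hz) as [d [Hd1 Hd2]].
  exists (d * bprod l z + bfactor a z * e)%C; split; [|split].
  + exact (second_order_mult _ _ _ _ _ Hd1 He1).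
  + simpl; rewrite RtoC_plus, Cmult_plus_distr_l, Cmult_assoc, Hd2.
    replace (z * (bfactor a z * e))%C with (bfactor a z * (z * e))%C by ring.
    rewrite He2; ring.
  + simpl; rewrite Cmod_mult, He3, bfactor_mod; [ring | apply Hl; left; reflexivity | exact Hz].
Qed.

Lemma poisson_sum_nonneg (l : list C) (z : C) :
  (forall a, In a l -> Cmod a < 1) -> Cmod z = 1 -> 0 <= poisson_sum l z.
Proof.
intros Hl Hz; induction l as [|a l IH]; simpl; [lra|].
apply Rplus_le_le_0_compat.
- apply poisson_nonneg; [apply Hl; left; reflexivity | exact Hz].
- apply IH; intros b Hb; apply Hl; right; exact Hb.
Qed.

(** Take moduli in z B' = P B, where |z| = |B| = 1 and P >= 0 is the Poisson sum; uniqueness of the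
    derivative handles an arbitrary [dz]. *)
Lemma deriv_mods_circle_bprod (l : list C) (r : R) : (forall a, In a l -> Cmod a < 1) ->
  deriv_mods_circle (bprod l) r <-> exists z, Cmod z = 1 /\ r = poisson_sum l z.
Proof.
intros Hl.
assert (H : forall z, Cmod z = 1 -> exists d,
  @is_derive C_AbsRing C_NormedModule (bprod l) z d /\ Cmod d = poisson_sum l z).
{ intros z Hz; destruct (bprod_second_order l z Hl Hz) as [d [Hd1 [Hd2 Hd3]]].
  exists d; split; [apply second_order_is_derive, Hd1|].
  assert (HC := f_equal Cmod Hd2); rewrite !Cmod_mult, Hz, Hd3, Cmod_R in HC.
  rewrite Rabs_pos_eq in HC; [lra | apply poisson_sum_nonneg; trivial]. }
split.
- intros [z [dz [Hz [Hd ->]]]]; exists z; split; [exact Hz|].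
  destruct (H z Hz) as [d [Hd1 Hd2]].
  rewrite <- Hd2, <- (is_C_derive_unique _ _ _ Hd1), (is_C_derive_unique _ _ _ Hd); reflexivity.
- intros [z [Hz ->]]; destruct (H z Hz) as [d [Hd1 Hd2]].
  exists z, d; split; [exact Hz | split; [exact Hd1 | symmetry; exact Hd2]].
Qed.

From mathcomp Require Import all_boot all_order all_algebra.
From mathcomp Require Import ring complex Rstruct.

(** * The zeros of the charge polynomial *)

Section ChargePolynomial.
Local Set Implicit Arguments.
Local Unset Strict Implicit.
Local Unset Printing Implicit Defensive.
Import Order.TTheory GRing.Theory Num.Theory.
Local Open Scope ring_scope.

Section LogDeriv.
Variable K : fieldType.

Lemma horner_deriv_prod_XsubC (I : eqType) (s : seq I) (P : pred I) (f : I -> K) (z : K) :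
  (forall i, i \in s -> P i -> z != f i) ->
  (\prod_(i <- s | P i) ('X - (f i)%:P))^`().[z] =
  (\prod_(i <- s | P i) ('X - (f i)%:P)).[z] * \sum_(i <- s | P i) (z - f i)^-1.
Proof.
elim: s => [|i s IHs] zf; first by rewrite !big_nil derivC horner0 mulr0.
rewrite !big_cons; case: ifP => [Pi|_]; last first.
  by apply: IHs => j js; apply: zf; rewrite inE js orbT.
rewrite derivM derivXsubC mul1r !hornerE IHs; last first.
  by move=> j js; apply: zf; rewrite inE js orbT.
have zi : z - f i != 0 by rewrite subr_eq0 zf ?mem_head.
by field.
Qed.

End LogDeriv.

(** * The ratios z / (z - u) on the unit circle *)

Section Circle.
Variable K : numClosedFieldType.
Implicit Types (a z u v : K).

Lemma unit_neq0 z : `|z| = 1 -> z != 0.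
Proof. by move=> z1; rewrite -normr_eq0 z1 oner_eq0. Qed.

Lemma conj_unit z : `|z| = 1 -> z^* = z^-1.
Proof.
move=> z1; have z0 := unit_neq0 z1.
apply: (mulfI z0); rewrite mulfV //.
by rewrite -normCK z1 expr1n.
Qed.

(** Substituting 1 / z for the conjugate of z makes both sides one rational function. The right side
    is 2 Re (z / (z - a)) - 1, so summing over the roots of p gives 2 Re (z p' / p) - deg p. *)
Lemma poisson_conj a z : `|z| = 1 -> z != a ->
  (1 - `|a| ^+ 2) / `|z - a| ^+ 2 = z / (z - a) + (z / (z - a))^* - 1.
Proof.
move=> z1 za; have z0 := unit_neq0 z1.
have za0 : z - a != 0 by rewrite subr_eq0.
have za0' : (z - a)^* != 0 by rewrite conjC_eq0.
rewrite !normCK; move: za0'; rewrite rmorphM fmorphV !rmorphB /= (conj_unit z1) => za0'.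
have za1 : 1 - a^* * z != 0.
  apply: contra za0' => /eqP e; have := congr1 (fun x => x / z) e.
  by rewrite mul0r mulrBl mul1r mulfK // => ->.
by field; rewrite z0 za0 andbT mulNr.
Qed.

(** The Poisson kernel vanishes for u on the circle, so z / (z - u) has real part 1/2. *)
Lemma unit_ratio_conj u z : `|z| = 1 -> `|u| = 1 -> z != u ->
  (z / (z - u))^* = 1 - z / (z - u).
Proof.
move=> z1 u1 zu; have /esym/eqP := poisson_conj z1 zu.
by rewrite u1 expr1n subrr mul0r subr_eq0 addrC eq_sym -subr_eq eq_sym => /eqP.
Qed.

Lemma unit_ratio_norm u z : `|z| = 1 -> `|u| = 1 -> z != u ->
  z / (z - u) * (1 - z / (z - u)) = `|z - u| ^- 2.
Proof.
move=> z1 u1 zu; rewrite -unit_ratio_conj // -normCK normrM normfV z1 mul1r.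
by rewrite exprVn.
Qed.

(* On the circle [z / (z - u) = (1 - i cot) / 2] for half the angle between [z] and [u], so this is
   the addition formula of the cotangent. *)
Lemma ratio_addition u v z : u != v -> z != u -> z != v ->
  let s := z / (z - u) in let t := z / (z - v) in
  s * (1 - t) + t * (1 - s) = (u + v) / (u - v) * (t - s).
Proof.
move=> uv zu zv s t; rewrite /s /t; field.
by rewrite !subr_eq0 uv zu zv.
Qed.

End Circle.

Section Equilibrium.
Variables (K : numClosedFieldType) (n : nat) (w ze : 'I_n.+1 -> K).
Hypothesis w0 : forall k, 0 < w k.
Hypothesis w1 : \sum_k w k = 1.
Hypothesis ze1 : forall k, `|ze k| = 1.
Hypothesis zeI : injective ze.
(** For ze_j = e^{is} and ze_k = e^{it} the quotient is -i cot ((s - t) / 2): the forces at ze_j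
    balance. *)
Hypothesis equil : forall j, \sum_(k | k != j) w k * ((ze j + ze k) / (ze j - ze k)) = 0.

(** The numerator of the field sum_k w_k / (z - ze_k); for equal weights it is the derivative of the
    nodal polynomial divided by n + 1. *)
Definition charge_poly : {poly K} :=
  \sum_k w k *: \prod_(j | j != k) ('X - (ze j)%:P).

Lemma size_node k : size (\prod_(j | j != k) ('X - (ze j)%:P)) = n.+1.
Proof.
rewrite -big_filter size_prod_XsubC size_filter -sum1_count sum1_card cardC1.
by rewrite card_ord.
Qed.

Lemma charge_poly_coef : charge_poly`_n = 1.
Proof.
rewrite coef_sum -w1; apply: eq_bigr => k _; rewrite coefZ.
have /monicP : \prod_(j | j != k) ('X - (ze j)%:P) \is monic by apply: monic_prod_XsubC.
by rewrite lead_coefE size_node => ->; rewrite mulr1.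
Qed.

Lemma size_charge_poly : size charge_poly = n.+1.
Proof.
apply/eqP; rewrite eqn_leq; apply/andP; split.
  apply: (leq_trans (size_sum _ _ _)); apply/bigmax_leqP => k _.
  by apply: (leq_trans (size_scale_leq _ _)); rewrite size_node.
rewrite ltnNge; apply/negP => /(nth_default 0) e.
by move/eqP: charge_poly_coef; rewrite e eq_sym oner_eq0.
Qed.

Lemma charge_poly_monic : charge_poly \is monic.
Proof. by apply/monicP; rewrite lead_coefE size_charge_poly charge_poly_coef. Qed.

Lemma node_horner k z : (forall j, z != ze j) ->
  (\prod_(j | j != k) ('X - (ze j)%:P)).[z] = (\prod_j ('X - (ze j)%:P)).[z] / (z - ze k).
Proof.
move=> zz; rewrite [in RHS](bigD1 k) //= hornerM !hornerE mulrAC divff ?mul1r //.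
by rewrite subr_eq0.
Qed.

Lemma charge_poly_horner z : (forall j, z != ze j) ->
  charge_poly.[z] = (\prod_j ('X - (ze j)%:P)).[z] * \sum_k w k / (z - ze k).
Proof.
move=> zz; rewrite horner_sum mulr_sumr; apply: eq_bigr => k _.
by rewrite hornerZ node_horner // mulrCA mulrA.
Qed.

Lemma charge_poly_deriv z : (forall j, z != ze j) ->
  charge_poly^`().[z] = (\prod_j ('X - (ze j)%:P)).[z] *
     \sum_k w k / (z - ze k) * (\sum_j (z - ze j)^-1 - (z - ze k)^-1).
Proof.
move=> zz; rewrite raddf_sum horner_sum mulr_sumr; apply: eq_bigr => k _ /=.
rewrite derivZ hornerZ horner_deriv_prod_XsubC // node_horner //.
rewrite [\sum_j _](bigD1 k) //= addrAC subrr add0r.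
by ring.
Qed.

Lemma nodes_horner_neq0 z : (forall j, z != ze j) -> (\prod_j ('X - (ze j)%:P)).[z] != 0.
Proof.
move=> zz; rewrite horner_prod; apply/prodf_neq0 => j _.
by rewrite !hornerE subr_eq0.
Qed.

Lemma node_at_neq0 i : (\prod_(j | j != i) ('X - (ze j)%:P)).[ze i] != 0.
Proof.
rewrite horner_prod; apply/prodf_neq0 => j ji.
by rewrite !hornerE subr_eq0 (inj_eq zeI) eq_sym.
Qed.

(** All summands but one contain the factor X - ze_i. This form gives value and derivative at a
    node, where the field is singular. *)
Lemma charge_poly_split i : charge_poly =
  w i *: \prod_(j | j != i) ('X - (ze j)%:P) +
  ('X - (ze i)%:P) * \sum_(k | k != i) w k *: \prod_(j | (j != i) && (j != k)) ('X - (ze j)%:P).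
Proof.
rewrite /charge_poly (bigD1 i) //=; congr (_ + _).
rewrite mulr_sumr; apply: eq_bigr => k ki.
rewrite (bigD1 i) 1?eq_sym //= -scalerAr; congr (_ *: (_ * _)).
by apply: eq_bigl => j; rewrite andbC.
Qed.

Lemma charge_poly_at i : charge_poly.[ze i] = w i * (\prod_(j | j != i) ('X - (ze j)%:P)).[ze i].
Proof. by rewrite (charge_poly_split i) !hornerE subrr mul0r addr0. Qed.

Lemma charge_poly_deriv_at i : charge_poly^`().[ze i] =
  (\prod_(j | j != i) ('X - (ze j)%:P)).[ze i] *
  \sum_(j | j != i) (w i + w j) / (ze i - ze j).
Proof.
rewrite (charge_poly_split i) derivD derivZ derivM derivXsubC mul1r !hornerE subrr /= mul0r addr0.
rewrite horner_deriv_prod_XsubC; last by move=> j _ ji; rewrite (inj_eq zeI) eq_sym.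
rewrite horner_sum mulrCA !mulr_sumr -big_split /=; apply: eq_bigr => k ki.
rewrite hornerZ [in RHS]mulrDl mulrDr; congr (_ + _).
have d0 : ze i - ze k != 0 by rewrite subr_eq0 (inj_eq zeI) eq_sym.
rewrite [in RHS](bigD1 k) //= hornerM !hornerE /=.
by field.
Qed.

(* As in Gauss-Lucas: at a root outside the nodes, the sum of [w_k (ze_k + a) / (ze_k - a)] is 1, and
   each term has real part of the sign of [1 - |a|^2]. *)
Lemma charge_poly_root_lt1 a : root charge_poly a -> `|a| < 1.
Proof.
move=> /rootP pa.
have az j : a != ze j.
  apply/negP => /eqP e; move/eqP: pa; rewrite e charge_poly_at mulf_eq0 (negPf (node_at_neq0 _)).
  by rewrite orbF gt_eqF.
move: pa; rewrite charge_poly_horner // => /eqP.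
rewrite mulf_eq0 (negPf (nodes_horner_neq0 az)) /= => /eqP S0.
have SX : \sum_k w k * ((ze k + a) / (ze k - a)) = 1.
  (* Here (ze_k + a) / (ze_k - a) = 1 - 2 a / (a - ze_k), and the field vanishes at the root [a]. *)
  have -> : 1 = \sum_k w k + (- 2 * a) * \sum_k w k / (a - ze k) by rewrite w1 S0 mulr0 addr0.
  rewrite mulr_sumr -big_split /=; apply: eq_bigr => k _.
  have d1 : a - ze k != 0 by rewrite subr_eq0.
  have d2 : ze k - a != 0 by rewrite subr_eq0 eq_sym.
  by field; rewrite d1 d2.
pose S := \sum_k w k * `|ze k - a| ^- 2.
(* The real part of (ze_k + a) / (ze_k - a) is (1 - |a|^2) / |ze_k - a|^2. *)
have SX2 : (1 - `|a| ^+ 2) * S = 1.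
  apply: (@mulfI _ 2); first by rewrite pnatr_eq0.
  transitivity (\sum_k w k * ((ze k + a) / (ze k - a)) + (\sum_k w k * ((ze k + a) / (ze k - a)))^*).
    rewrite rmorph_sum -big_split !mulr_sumr /=; apply: eq_bigr => k _.
    have zk0 := unit_neq0 (ze1 k).
    have d1 : ze k - a != 0 by rewrite subr_eq0 eq_sym.
    have d2 : (ze k - a)^* != 0 by rewrite conjC_eq0.
    have wk : (w k)^* = w k by apply/CrealP/gtr0_real.
    rewrite rmorphM rmorphM fmorphV /= wk !normCK; move: d2.
    rewrite !rmorphB !rmorphD /= (conj_unit (ze1 k)) => d2.
    have d3 : 1 - a^* * ze k != 0.
      apply: contra d2 => /eqP e; have := congr1 (fun x => x / ze k) e.
      by rewrite mul0r mulrBl mul1r mulfK // => ->.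
    by field; rewrite zk0 d1 andbT mulNr.
  by rewrite SX rmorph1 mulr1 -[2]/(1 + 1).
have S0' : 0 <= S.
  apply: sumr_ge0 => k _; apply: mulr_ge0; first exact: ltW.
  by rewrite invr_ge0 exprn_ge0.
have Spos : 0 < S.
  rewrite lt_def S0' andbT; apply: contraTneq isT => e.
  by move: SX2; rewrite e mulr0 => /esym/eqP; rewrite oner_eq0.
have : 0 < (1 - `|a| ^+ 2) * S by rewrite SX2.
rewrite pmulr_lgt0 // subr_gt0 => a2.
by rewrite -(@ltr_pXn2r _ 2) ?nnegrE ?normr_ge0 ?ler01 // expr1n.
Qed.

(* Summing [ratio_addition] over the pairs of nodes, the off-diagonal terms cancel at equilibrium. *)
Lemma weighted_ratio_identity z : (forall j, z != ze j) ->
  let W := \sum_k w k * (z / (z - ze k)) in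
  W * (1 - W) = \sum_k w k ^+ 2 * (z / (z - ze k) * (1 - z / (z - ze k))).
Proof.
move=> zz W; pose t k := z / (z - ze k).
(* By [ratio_addition] each term is w_j w_k e_jk (t_k - t_j). The t_j part vanishes by equilibrium
   at j, the t_k part by equilibrium at k and antisymmetry of e. *)
have pair_sum : \sum_j \sum_(k | k != j) w j * w k * (t j * (1 - t k) + t k * (1 - t j)) = 0.
  pose e j k := (ze j + ze k) / (ze j - ze k).
  have E1 : \sum_j \sum_(k | k != j) w j * w k * (e j k * t j) = 0.
    rewrite big1 // => j _; transitivity (w j * t j * \sum_(k | k != j) w k * e j k).
      by rewrite mulr_sumr; apply: eq_bigr => k _; ring.
    by rewrite equil mulr0.
  have E2 : \sum_j \sum_(k | k != j) w j * w k * (e j k * t k) = 0.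
    rewrite (exchange_big_dep predT) //= big1 // => k _.
    transitivity (- (w k * t k) * \sum_(j | j != k) w j * e k j); last by rewrite equil mulr0.
    rewrite mulr_sumr; apply: eq_big => [j|j jk]; first by rewrite eq_sym.
    by rewrite /e -opprB invrN mulrN addrC; ring.
  rewrite -[RHS](subrr 0) -[X in X - _]E2 -[X in _ - X]E1 -sumrB; apply: eq_bigr => j _.
  rewrite -sumrB; apply: eq_bigr => k kj.
  rewrite /t ratio_addition // ?(inj_eq zeI) 1?eq_sym // -/(t j) -/(t k) /e; ring.
(* The weights sum to 1, so 1 - W = sum_k w_k (1 - t_k); symmetrising the double sum doubles W (1 -
   W). *)
have D : \sum_j \sum_k w j * w k * (t j * (1 - t k) + t k * (1 - t j)) = 2 * (W * (1 - W)).
  have -> : W * (1 - W) = \sum_j \sum_k w j * w k * (t j * (1 - t k)).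
    rewrite -[X in _ * (X - _)]w1 -sumrB mulr_suml; apply: eq_bigr => j _.
    rewrite mulr_sumr; apply: eq_bigr => k _; rewrite -/(t j) -/(t k); ring.
  rewrite mulr_natl mulr2n [X in _ = X + _]exchange_big /= -big_split; apply: eq_bigr => j _ /=.
  by rewrite -big_split; apply: eq_bigr => k _ /=; ring.
apply: (@mulfI _ 2); first by rewrite pnatr_eq0.
rewrite -D.
transitivity (\sum_j 2 * (w j ^+ 2 * (t j * (1 - t j))) +
  \sum_j \sum_(k | k != j) w j * w k * (t j * (1 - t k) + t k * (1 - t j))); last first.
  by rewrite pair_sum addr0 mulr_sumr.
rewrite -big_split; apply: eq_bigr => j _ /=.
by rewrite (bigD1 j) //=; congr (_ + _); ring.
Qed.

Lemma horner_deriv_roots (r : seq K) z : charge_poly = \prod_(a <- r) ('X - a%:P) ->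
  ~~ root charge_poly z ->
  \sum_(a <- r) z / (z - a) = z * charge_poly^`().[z] / charge_poly.[z].
Proof.
move=> er; rewrite er root_prod_XsubC => zr.
have p0 : (\prod_(a <- r) ('X - a%:P)).[z] != 0 by rewrite -rootE root_prod_XsubC.
rewrite horner_deriv_prod_XsubC; last by move=> a ar _; apply: contraNneq zr => ->.
by rewrite mulrCA mulrAC mulfV // mul1r mulr_sumr.
Qed.

(** The zeros are the roots of the charge polynomial p, and F is a real part of z p' / p. Nodes are
    treated apart because 1 / |z - ze_k|^2 blows up there. *)
Lemma blaschke_zeros : exists r : seq K,
  [/\ size r = n, forall a, a \in r -> `|a| < 1 &
   forall z, `|z| = 1 ->
    let F := \sum_(a <- r) (1 - `|a| ^+ 2) / `|z - a| ^+ 2 in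
    (forall i, z = ze i -> F + 1 = (w i)^-1) /\
    ((forall i, z != ze i) ->
      (F + 1) * (\sum_k w k ^+ 2 / `|z - ze k| ^+ 2) = \sum_k w k / `|z - ze k| ^+ 2)].
Proof.
have [r er] := closed_field_poly_normal charge_poly.
have {}er : charge_poly = \prod_(a <- r) ('X - a%:P).
  by rewrite {1}er (monicP charge_poly_monic) scale1r.
have rsz : size r = n by have := size_charge_poly; rewrite er size_prod_XsubC => -[].
have rlt a : a \in r -> `|a| < 1.
  by move=> ar; apply: charge_poly_root_lt1; rewrite er root_prod_XsubC.
exists r; split=> // z z1 F.
have z0 := unit_neq0 z1.
have zr : ~~ root charge_poly z by apply/negP => /charge_poly_root_lt1; rewrite z1 ltxx.
have p0 : charge_poly.[z] != 0 by [].
(* Sum of [poisson_conj] over the n roots. *)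
have FE : F = z * charge_poly^`().[z] / charge_poly.[z] +
    (z * charge_poly^`().[z] / charge_poly.[z])^* - n%:R.
  rewrite -(horner_deriv_roots er zr) rmorph_sum -big_split /= /F -rsz.
  rewrite -sum1_size natr_sum -sumrB [LHS]big_seq [RHS]big_seq; apply: eq_bigr => a ar.
  by apply: poisson_conj => //; apply: contraTneq (rlt a ar) => <-; rewrite z1 ltxx.
have wk k : w k != 0 by rewrite gt_eqF.
have wc k : (w k)^* = w k by apply/CrealP/gtr0_real.
have tc k : z != ze k -> z / (z - ze k) + (z / (z - ze k))^* = 1.
  by move=> zk; rewrite unit_ratio_conj // addrC subrK.
split=> [i zi|zz].
- have zk k : k != i -> z != ze k by rewrite zi (inj_eq zeI) eq_sym.
  have LE : z * charge_poly^`().[z] / charge_poly.[z] =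
      \sum_(j | j != i) (w i + w j) / w i * (z / (z - ze j)).
    rewrite zi charge_poly_deriv_at charge_poly_at mulrCA.
    rewrite [w i * _]mulrC -mulf_div divff ?mul1r ?node_at_neq0 // mulr_sumr mulr_suml.
    by apply: eq_bigr => j ji; ring.
  rewrite FE LE rmorph_sum -big_split /=.
  (* Each z / (z - ze_j) has real part 1/2, so doubling the real part leaves its real coefficient 1
     + w_j / w_i; the n terms add up to n + (1 - w_i) / w_i. *)
  rewrite (eq_bigr (fun j => 1 + w j / w i)); last first.
    move=> j /zk /tc e.
    have cr : ((w i + w j) / w i)^* = (w i + w j) / w i.
      by rewrite rmorphM fmorphV rmorphD /= !wc.
    by rewrite rmorphM /= cr -mulrDr e mulr1; field.
  rewrite big_split /= sumr_const cardC1 card_ord -mulr_suml.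
  have -> : \sum_(j | j != i) w j = 1 - w i by rewrite -w1 [in RHS](bigD1 i) //= [w i + _]addrC addrK.
  by field.
- pose t k := z / (z - ze k).
  pose W := \sum_k w k * t k; pose Y := \sum_k w k * (t k * (1 - t k)).
  have Wc : W^* = 1 - W.
    rewrite -w1 -sumrB rmorph_sum; apply: eq_bigr => k _.
    by rewrite rmorphM /= wc unit_ratio_conj // -/(t k); ring.
  pose S := \sum_k w k / (z - ze k).
  pose S2 := \sum_k w k / (z - ze k) ^+ 2.
  pose L := \sum_k (z - ze k)^-1.
  have zk k : z - ze k != 0 by rewrite subr_eq0.
  have Q0 := nodes_horner_neq0 zz.
  have S0 : S != 0.
    by move: p0; rewrite charge_poly_horner // mulf_eq0 negb_or => /andP[].
  have WE : W = z * S by rewrite mulr_sumr; apply: eq_bigr => k _; rewrite /t; ring.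
  have TE : \sum_k t k = z * L by rewrite mulr_sumr.
  have YE : Y = W - z ^+ 2 * S2.
    rewrite mulr_sumr -sumrB; apply: eq_bigr => k _; rewrite /t.
    by field.
  have W0 : W != 0 by rewrite WE mulf_neq0.
  (* With Q the nodal polynomial, p = Q S and S' = -S2, so z p' / p = z L - z S2 / S, where z^2 S2 =
     W - Y and W = z S. *)
  have LE : z * charge_poly^`().[z] / charge_poly.[z] = \sum_j t j - 1 + Y / W.
    have AE : \sum_k w k / (z - ze k) * (L - (z - ze k)^-1) = L * S - S2.
      rewrite mulr_sumr -sumrB; apply: eq_bigr => k _; by field.
    rewrite charge_poly_deriv // charge_poly_horner // -/L AE -/S TE YE WE.
    by field; rewrite z0 S0 Q0.
  have W0' : 1 - W != 0 by rewrite -Wc conjC_eq0.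
  have tn k : t k * (1 - t k) = `|z - ze k| ^- 2 by apply: unit_ratio_norm.
  have Yc : Y^* = Y.
    rewrite rmorph_sum; apply: eq_bigr => k _.
    by rewrite rmorphM /= wc tn conj_Creal // rpredV rpredX // normr_real.
  have Tc : \sum_j t j + (\sum_j t j)^* = n.+1%:R.
    rewrite rmorph_sum -big_split /= -[in RHS](card_ord n.+1) -sum1_card natr_sum.
    by apply: eq_bigr => k _; apply: tc.
  (* Conjugation fixes Y and sends W to 1 - W, so F + 1 = Y / W + Y / (1 - W). *)
  have FW : (F + 1) * (W * (1 - W)) = Y.
    have -> : F = n.+1%:R - 2 + Y / W + Y / (1 - W) - n%:R.
      rewrite FE LE -Tc !rmorphD rmorphN rmorph1 rmorphM fmorphV /= Wc Yc; ring.
    by rewrite -addn1 natrD; field; rewrite W0 W0'.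
  rewrite -[RHS](_ : Y = _); last by apply: eq_bigr => k _; rewrite tn.
  (* The equilibrium enters here, through the value of W (1 - W). *)
  rewrite -FW (weighted_ratio_identity zz); congr (_ * _).
  by apply: eq_bigr => k _; rewrite -/(t k) tn.
Qed.

End Equilibrium.

End ChargePolynomial.

(** * Transfer from [R[i]] to Coquelicot's complex numbers *)

Section Bridge.
Import Order.TTheory GRing.Theory Num.Theory.
Local Open Scope ring_scope.

Definition to_C (x : R[i]) : C := (complex.Re x, complex.Im x).

Lemma normc_Cmod (x : R[i]) : `|x| = (Cmod (to_C x))%:C%C.
Proof. by case: x => a b; rewrite normc_def /Cmod RsqrtE !RpowE. Qed.

Lemma poisson_complex (a z : R[i]) :
  (1 - `|a| ^+ 2) / `|z - a| ^+ 2 = (poisson (to_C a) (to_C z))%:C%C.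
Proof.
rewrite !normc_Cmod /poisson !RpowE.
have -> : Cminus (to_C z) (to_C a) = to_C (z - a) by case: a => a1 a2; case: z => z1 z2.
by rewrite RdivE RminusE rmorphM fmorphV rmorphB rmorph1 !rmorphXn.
Qed.

Lemma poisson_sum_complex (r : seq R[i]) (z : R[i]) :
  \sum_(a <- r) (1 - `|a| ^+ 2) / `|z - a| ^+ 2 =
  (poisson_sum (List.map to_C r) (to_C z))%:C%C.
Proof.
elim: r => [|a r IHr]; first by rewrite big_nil.
by rewrite big_cons IHr poisson_complex /= -rmorphD.
Qed.

Lemma In_map_to_C (r : seq R[i]) (c : C) :
  In c (List.map to_C r) -> exists2 a, a \in r & c = to_C a.
Proof.
elim: r => //= a r IHr [<-|/IHr[b br ->]]; first by exists a; rewrite ?mem_head.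
by exists b; rewrite // inE br orbT.
Qed.

Definition expi (x : R) : R[i] := Complex (cos x) (sin x).

Lemma sin_mul_cos_mul (x : R) : sin x * sin x + cos x * cos x = 1.
Proof. exact: sin2_cos2. Qed.

Lemma expi_norm (x : R) : `|expi x| = 1.
Proof. by rewrite normc_def /= !expr2 addrC sin_mul_cos_mul sqrtr1. Qed.

Lemma cos_sub (x y : R) : cos (x - y) = cos x * cos y + sin x * sin y.
Proof. exact: cos_minus. Qed.

Lemma sin_sub (x y : R) : sin (x - y) = sin x * cos y - cos x * sin y.
Proof. exact: sin_minus. Qed.

(** The value is -i cot ((x - y) / 2) without half-angles; it carries the real equilibrium over to
    the complex one. *)
Lemma expi_cot (x y : R) : cos (x - y) < 1 ->
  (expi x + expi y) / (expi x - expi y) =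
  Complex 0 (- (sin (x - y) / (1 - cos (x - y)))).
Proof.
move=> c1.
have d0 : 1 - cos (x - y) != 0 by rewrite subr_eq0 gt_eqF.
have z0 : expi x - expi y != 0.
  rewrite subr_eq0; apply: contraTneq c1 => -[e1 e2].
  by rewrite -leNgt cos_sub e1 e2 addrC sin_mul_cos_mul.
apply: (mulIf z0); rewrite mulfVK //.
have ex : sin x * sin x = 1 - cos x * cos x by rewrite -(sin_mul_cos_mul x) addrK.
have ey : sin y * sin y = 1 - cos y * cos y by rewrite -(sin_mul_cos_mul y) addrK.
pose k := sin (x - y) / (1 - cos (x - y)).
have E1 : cos x + cos y = k * (sin x - sin y).
  apply: (mulIf d0); rewrite mulrAC /k mulfVK // cos_sub sin_sub.
  ring: ex ey.
have E2 : sin x + sin y = - k * (cos x - cos y).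
  apply: (mulIf d0); rewrite mulrAC /k mulNr mulfVK // cos_sub sin_sub.
  ring: ex ey.
rewrite -/k /expi; apply/eqP; rewrite eq_complex /=; apply/andP; split; apply/eqP.
  rewrite E1; ring.
rewrite E2; ring.
Qed.

Local Open Scope R_scope.

(** Real form of [blaschke_zeros] with nodes e^{i x_k}. The y_k stand for 1 / |z - e^{i x_k}|^2;
    only their positivity matters for the average. *)
Lemma blaschke_of_charges (n : nat) (w x : nat -> R) :
  (forall k, 0 < w k) -> sum_f_R0 w n = 1 -> separated n x ->
  (forall i, (i <= n)%coq_nat ->
    sum_f_R0 (fun k => match Nat.eq_dec i k with
      | left _ => 0
      | right _ => w k * (sin (x i - x k) / (1 - cos (x i - x k)))
      end) n = 0) ->
  exists l : list C, length l = n /\ (forall a, In a l -> Cmod a < 1) /\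
   forall z, Cmod z = 1 ->
    (forall i, (i <= n)%coq_nat -> z = (cos (x i), sin (x i)) -> poisson_sum l z + 1 = / w i) /\
    ((forall i, (i <= n)%coq_nat -> z <> (cos (x i), sin (x i))) ->
      exists y : nat -> R, (forall k, (k <= n)%coq_nat -> 0 < y k) /\
       (poisson_sum l z + 1) * sum_f_R0 (fun k => w k * w k * y k) n =
       sum_f_R0 (fun k => w k * y k) n).
Proof.
Local Open Scope ring_scope.
move=> w_gt0 w1 sep eqx.
have sumE (f : nat -> R) : sum_f_R0 f n = \sum_(k < n.+1) f k by rewrite sum_f_R0E big_mkord.
have le_ord (k : 'I_n.+1) : (k <= n)%coq_nat by apply/ssrnat.leP; rewrite -ltnS.
have sepo (j k : 'I_n.+1) : j != k -> cos (x j - x k) < 1.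
  by move=> jk; apply/RltP; apply: sep => // /val_inj/eqP; rewrite (negPf jk).
have [||||j|r [rsz rlt rE]] := @blaschke_zeros R[i] n
    (fun k => (w k)%:C%C) (fun k => expi (x k)).
- by move=> k; rewrite ltcR; apply/RltP.
- by rewrite -rmorph_sum -sumE w1.
- by move=> k; apply: expi_norm.
- move=> j k [e1 e2]; apply/eqP; apply/negPn/negP => /sepo.
  by rewrite cos_sub e1 e2 addrC sin_mul_cos_mul ltxx.
- transitivity (Complex 0 (- \sum_(k < n.+1 | k != j)
      w k * (sin (x j - x k) / (1 - cos (x j - x k))))).
    pose F (t : R) : R[i] := Complex 0 (- t).
    have FD : {morph F : s t / s + t} by move=> s t; congr Complex; rewrite ?addr0 ?opprD.
    have F0 : F 0 = 0 by congr Complex; rewrite oppr0.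
    rewrite -/(F _) (big_morph F FD F0); apply: eq_bigr => k kj.
    rewrite expi_cot; last by apply: sepo; rewrite eq_sym.
    by apply/eqP; rewrite eq_complex /=; apply/andP; split; apply/eqP; ring.
  have ej := eqx j (le_ord j); rewrite sumE in ej.
  rewrite [X in - X](_ : _ = 0) ?oppr0 // -[RHS]ej big_mkcond; apply: eq_bigr => k _ /=.
  case: Nat.eq_dec => jk; case: eqVneq => //= kj; last by case: jk; rewrite kj.
  by case/eqP: kj; apply: val_inj.
exists (List.map to_C r); split; first by rewrite length_map.
split=> [c /In_map_to_C[a ar ->]|[u v] zz].
  by apply/RltP; rewrite -ltcR -normc_Cmod; exact: rlt.
have nz : `|Complex u v| = 1 by rewrite normc_Cmod /= zz.
have [rE1 rE2] := rE _ nz; split.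
- move=> i /ssrnat.leP; rewrite -ltnS => lin [eu ev].
  have := rE1 (Ordinal lin); rewrite /= /expi -eu -ev => /(_ erefl).
  rewrite poisson_sum_complex -fmorphV -[1]/(1%:C%C) -rmorphD => -[]; exact.
- move=> zx; pose y k := (Cmod (to_C (Complex u v - expi (x k)))) ^- 2.
  have y_gt0 k : (k <= n)%coq_nat -> 0 < y k.
    move=> kn; rewrite invr_gt0 exprn_gt0 // -ltcR -normc_Cmod normr_gt0 subr_eq0.
    by apply/eqP => -[eu ev]; apply: (zx k kn); rewrite eu ev.
  exists y; split=> [k /y_gt0 /RltP //|].
  have zx' (i : 'I_n.+1) : Complex u v != expi (x i).
    by apply/eqP => -[eu ev]; apply: (zx i (le_ord i)); rewrite eu ev.
  have yE k : `|Complex u v - expi (x k)| ^- 2 = (y k)%:C%C.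
    by rewrite normc_Cmod -rmorphXn -fmorphV.
  have := rE2 zx'; rewrite poisson_sum_complex -[1]/(1%:C%C) -rmorphD !sumE.
  under eq_bigr do rewrite yE -rmorphXn -rmorphM expr2.
  under [RHS]eq_bigr do rewrite yE -rmorphM.
  by rewrite -!rmorph_sum -rmorphM => -[].
Qed.

End Bridge.

(** * Extremal values of the derivative, attained at the nodes *)

Theorem theorem1 (n : nat) (m M : R) :
  0 < m -> 0 < M ->
  INR n / (M - INR n + 1) <= m -> m <= INR n - 1 + INR n / M ->
  m <= INR n -> INR n <= M ->
  exists B : C -> C, is_blaschke n B /\ Msup B M /\ minf B m.
Proof.
intros Hm HM H1 H2 H3 H4.
destruct (charge_weights n m M Hm HM H1 H2 H3 H4) as [w [Hw [Hsum [Hw0 Hw1]]]].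
assert (Ha : 0 < / (1 + M)) by (apply Rinv_0_lt_compat; lra).
assert (Hpos : forall k, 0 < w k) by (intros k; specialize (Hw k); lra).
destruct (equilibrium n w Hpos) as [x [Hsep Heq]].
destruct (blaschke_of_charges n w x Hpos Hsum Hsep Heq) as [l [Hlen [Hl HF]]].
assert (Hn : (1 <= n)%coq_nat) by (destruct n; [simpl in H3; lra | lia]).
(* |B'| + 1 is some 1 / w_i at a node and an average of them elsewhere; either way it lies between 1
   + m and 1 + M. *)
assert (Hbounds : forall z, Cmod z = 1 -> m <= poisson_sum l z <= M).
{ intros z Hz; destruct (HF z Hz) as [HF1 HF2].
  enough (/ / (1 + m) <= poisson_sum l z + 1 <= / / (1 + M)) by (rewrite !Rinv_inv in H; lra).
  destruct (classic (exists i, (i <= n)%coq_nat /\ z = (cos (x i), sin (x i)))) as [[i [Hi Hzi]]|Hno].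
  - rewrite (HF1 i Hi Hzi); specialize (Hw i); specialize (Hpos i).
    split; apply Rinv_le_contravar; lra.
  - destruct HF2 as [y [Hy1 Hy2]]; [intros i Hi Hzi; apply Hno; eauto|].
    exact (weighted_average_bounds n w y _ _ _ Ha Hw Hy1 Hy2). }
assert (Hnode : forall i, (i <= n)%coq_nat -> deriv_mods_circle (bprod l) (/ w i - 1)).
{ intros i Hi; apply (deriv_mods_circle_bprod l _ Hl).
  assert (Hz : Cmod (cos (x i), sin (x i)) = 1).
  { unfold Cmod; simpl; rewrite !Rmult_1_r Rplus_comm.
    change (sqrt (Rsqr (sin (x i)) + Rsqr (cos (x i))) = 1).
    rewrite sin2_cos2; apply sqrt_1. }
  exists (cos (x i), sin (x i)); split; [exact Hz|].
  destruct (HF _ Hz) as [HF1 _]; rewrite <- (HF1 i Hi Logic.eq_refl); lra. }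
exists (bprod l); split; [|split].
- exists 1%C, l; repeat split; trivial; [apply Cmod_1|].
  intros z; symmetry; apply Cmult_1_l.
- split.
  + intros r Hr; apply (deriv_mods_circle_bprod l r Hl) in Hr.
    destruct Hr as [z [Hz ->]]; apply Hbounds, Hz.
  (* The supremum is attained at node 0; likewise the infimum at node 1, which exists since n >=
     1. *)
  + intros b Hb; apply Hb; replace M with (/ w 0%nat - 1); [apply Hnode; lia|].
    rewrite Hw0 Rinv_inv; lra.
- split.
  + intros r Hr; apply (deriv_mods_circle_bprod l r Hl) in Hr.
    destruct Hr as [z [Hz ->]]; apply Hbounds, Hz.
  + intros b Hb; apply Hb; replace m with (/ w 1%nat - 1); [apply Hnode; lia|].
    rewrite Hw1 Rinv_inv; lra.
Qed.
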